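(* Let $N=3$, $m_0(z)=\frac{1+z^2}{\sqrt2}$, and let $m$ be the measure on the solenoid $\mathcal{S}_3$ associated to $W=|m_0|^2/3$. For $\lambda\in\mathbb{Z}[1/3]$ let $\hat m(\lambda)=\int_{\mathcal{S}_3}\chi_\lambda\,dm$. Then $m$ has the following Fourier coefficients: $$\hat m(\lambda)=\begin{cases}2^{-(|d_0|+|d_1|+\dots+|d_p|)/2},&\text{if }\lambda=\sum_{k=0}^{p}\frac{d_k}{3^{k}}\text{ with } d_k\in\{-2,0,2\},\\ 0,&\text{otherwise.}\end{cases}$$
   Context: Let $N=3$. $\mathcal{S}_3=\{(z_n)_{n\in\mathbb{Z}}\mid z_{n+1}^3=z_n,\ |z_n|=1\}$ (elements are determined by $(z_n)_{n\ge0}$). For $\lambda=k/3^p\in\mathbb{Z}[1/3]$, $\chi_\lambda((z_n)_n)=z_p^k$. Functions $f$ on the unit circle are identified with functions on $[0,1)$ by $f(x):=f(e^{-2\pi i x})$. Measure $m$ associated to $W$ (here $W\ge0$ and $\sum_{k=0}^{2}W(\tau_kx)=1$, where $\tau_k(x)=\frac{x+k}{3}$): let $\Omega=\{0,1,2\}^{\{1,2,\dots\}}$. For $x\in[0,1)$, $P_x$ is the Borel probability measure on $\Omega$ such that, for $f$ depending only on $\omega_1,\dots,\omega_n$, $\int_\Omega f\,dP_x=\sum_{\omega_1,\dots,\omega_n}f(\omega_1,\dots,\omega_n)W(\tau_{\omega_1}x)W(\tau_{\omega_2}\tau_{\omega_1}x)\cdots W(\tau_{\omega_n}\cdots\tau_{\omega_1}x)$.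 With $\Phi(x,\omega)=(e^{-2\pi i x},e^{-2\pi i\tau_{\omega_1}x},e^{-2\pi i\tau_{\omega_2}\tau_{\omega_1}x},\dots)$ (coordinates $z_0,z_1,z_2,\dots$), a measurable bijection $[0,1)\times\Omega\to\mathcal{S}_3$, $m$ is the Borel probability measure on $\mathcal{S}_3$ with $\int f\,dm=\int_0^1\int_\Omega f(\Phi(x,\omega))\,dP_x(\omega)\,dx$ for $f\in C(\mathcal{S}_3)$.
   Formalization: The digit sum runs over k = 1,…,p instead of 0,…,p (d_0 = 0); any λ needing d_0 ≠ 0 falls under ''otherwise'' with coefficient 0. As printed the claim is false: z_0 is uniformly distributed, so the coefficient at λ = 2 is 0, not 1/2. *)

(* Defs.v *)
From HB Require Import structures.
From mathcomp Require Import all_boot all_order all_algebra.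
From mathcomp Require Import all_classical all_reals all_analysis.
From mathcomp Require Import complex.
From mathcomp Require Import ring.

Set Implicit Arguments.
Unset Strict Implicit.
Unset Printing Implicit Defensive.

Import Order.TTheory GRing.Theory Num.Theory.
Import numFieldNormedType.Exports.
Local Open Scope classical_set_scope.
Local Open Scope ring_scope.
Local Open Scope complex_scope.

Definition Cintegral d (T : measurableType d) (R : realType)
    (mu : {measure set T -> \bar R}) (D : set T) (f : T -> R[i]) : R[i] :=
  Rintegral mu D (fun t => complex.Re (f t)) +i*
  Rintegral mu D (fun t => complex.Im (f t)).

(* e^{-2 pi i x}; a function f on the unit circle is read as the function
   f \o circ on [0, 1). *)
Definition circ (R : realType) (x : R) : R[i] :=
  cos (2 * pi * x) -i* sin (2 * pi * x).

Lemma circD (R : realType) (x y : R) : circ (x + y) = circ x * circ y.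
Proof.
rewrite /circ mulrDr cosD sinD; apply/eqP.
rewrite eq_complex /=; apply/andP; split; apply/eqP; ring.
Qed.

Lemma circ0 (R : realType) : circ (0 : R) = 1.
Proof. by rewrite /circ mulr0 cos0 sin0 oppr0. Qed.

Lemma circMn (R : realType) (x : R) (n : nat) : circ (x *+ n) = circ x ^+ n.
Proof. by elim: n => [|n IH]; rewrite ?circ0// mulrS circD IH exprS. Qed.

Lemma circ1 (R : realType) : circ (1 : R) = 1.
Proof.
by rewrite /circ mulr1 mulr_natl cos2pi sin2pi oppr0.
Qed.

Lemma circ_nat (R : realType) (n : nat) : circ (n%:R : R) = 1.
Proof. by rewrite circMn circ1 expr1n. Qed.

Lemma circ_norm (R : realType) (x : R) : `|circ x| = 1.
Proof.
by rewrite /circ normc_def /= sqrrN cos2Dsin2 sqrtr1.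
Qed.

(* R[i]^o carries the usual topology of the complex numbers, {ptws _ -> _} the
   product topology and set_type the subspace topology. *)
Definition solenoid_set (R : realType) : set {ptws int -> R[i]^o} :=
  [set z | forall n : int, z (n + 1) ^+ 3 = z n /\ `|z n| = 1].

Arguments solenoid_set R : clear implicits.

Definition solenoid (R : realType) : Type := set_type (solenoid_set R).

HB.instance Definition _ (R : realType) :=
  Topological.copy (solenoid R) (set_type (solenoid_set R)).

Definition solenoid_coord (R : realType) (z : solenoid R) (n : int) : R[i] :=
  set_val z n.

Lemma solenoid_one (R : realType) :
  (fun=> 1) \in solenoid_set R.
Proof. by apply/mem_set => n /=; rewrite expr1n normr1. Qed.

HB.instance Definition _ (R : realType) :=
  isPointed.Build (solenoid R) (SigSub (@solenoid_one R) : solenoid_set R).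

Definition solenoid_borel (R : realType) :=
  g_sigma_algebraType (@open (solenoid R)).

Definition triadic (lam : rat) : Prop :=
  exists (k : int) (p : nat), lam = k%:~R / 3 ^+ p.

(* Uses the reduced form of lam; chiE shows that any form k / 3 ^ p will do. *)
Definition chi (R : realType) (lam : rat) (z : solenoid R) : R[i] :=
  solenoid_coord z (logn 3 `|denq lam|)%:Z ^ numq lam.

Lemma coord_expn (R : realType) (z : solenoid R) (q j : nat) :
  solenoid_coord z (q + j)%N%:Z ^+ (3 ^ j) = solenoid_coord z q%:Z.
Proof.
elim: j => [|j IH]; first by rewrite addn0 expn0 expr1.
rewrite expnS exprM -[RHS]IH; congr (_ ^+ _).
have /(_ (q + j)%N%:Z) /= [+ _] : solenoid_set R (set_val z) by exact: set_valP.
by rewrite /solenoid_coord addnS -[(q + j).+1]addn1 PoszD.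
Qed.

Lemma chiE (R : realType) (k : int) (p : nat) (z : solenoid R) :
  chi (k%:~R / 3 ^+ p) z = solenoid_coord z p%:Z ^ k.
Proof.
move lamE : (k%:~R / 3 ^+ p) => lam; rewrite /chi.
have H : numq lam * 3 ^+ p = k * denq lam.
  apply: (@intr_inj rat); rewrite !rmorphM rmorphXn /= numqE -{1}lamE.
  by rewrite mulrAC divfK// expf_neq0.
have : (`|denq lam| %| 3 ^ p)%N.
  rewrite -(@Gauss_dvdr _ `|numq lam|); last first.
    by rewrite coprime_sym coprime_num_den.
  apply/dvdnP; exists `|k|%N.
  by have /(congr1 absz) := H; rewrite !abszM abszX.
move=> /(dvdn_pfactor _ _ (isT : prime 3))[q qp denE].
rewrite denE pfactorK//.
have denZ : denq lam = 3 ^+ q.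
  by rewrite -[LHS]gez0_abs ?denq_ge0// denE -natz natrX.
have kE : k = numq lam * 3 ^+ (p - q)%N.
  have q0 : (3 ^+ q : int) != 0 by rewrite expf_neq0.
  apply: (mulIf q0).
  by rewrite -denZ -H denZ -mulrA -exprD subnK.
rewrite kE; move: (numq lam) (p - q)%N (subnKC qp) => u j <-.
have -> : (3 ^+ j : int) = (3 ^ j)%N%:Z by rewrite -natz natrX.
by rewrite mulrC -exprz_exp -exprnP coord_expn.
Qed.

HB.instance Definition _ (n : nat) := isPointed.Build 'I_n.+1 ord0.

(* The index set {1, 2, ...} is shifted to nat: w n is the letter omega_{n+1}. *)
Definition Omega : Type := {ptws nat -> discrete_topology 'I_3}.

HB.instance Definition _ :=
  Topological.copy Omega {ptws nat -> discrete_topology 'I_3}.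
HB.instance Definition _ := Pointed.copy Omega (nat -> 'I_3).

Definition Omega_borel := g_sigma_algebraType (@open Omega).

Definition tau (R : realType) (k : 'I_3) (x : R) : R := (x + k%:R) / 3.

(* tau_{omega_n} ... tau_{omega_1} x for s = [:: omega_1; ...; omega_n] *)
Definition tau_seq (R : realType) (x : R) (s : seq 'I_3) : R :=
  foldl (fun y k => tau k y) x s.

(* Coordinates of negative index are forced by z_{-n} = z_0 ^ (3 ^ n). *)
Definition Phi_fun (R : realType) (x : R) (w : Omega) (n : int) : R[i] :=
  match n with
  | Posz n => circ (tau_seq x (mkseq w n))
  | Negz n => circ x ^+ (3 ^ n.+1)
  end.

Lemma tau_seqS (R : realType) (x : R) (w : nat -> 'I_3) (n : nat) :
  tau_seq x (mkseq w n.+1) = tau (w n) (tau_seq x (mkseq w n)).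
Proof. by rewrite mkseqS /tau_seq foldl_rcons. Qed.

Lemma circ_tau (R : realType) (k : 'I_3) (x : R) : circ (tau k x) ^+ 3 = circ x.
Proof.
rewrite -circMn /tau.
have -> : (x + k%:R) / 3 *+ 3 = x + k%:R by rewrite -mulr_natr; field.
by rewrite circD circ_nat mulr1.
Qed.

Lemma Phi_in (R : realType) (x : R) (w : Omega) :
  (Phi_fun x w : {ptws int -> R[i]^o}) \in solenoid_set R.
Proof.
apply/mem_set => -[n|n]; split; last 2 first.
- case: n => [|n].
    by rewrite (_ : Negz 0 + 1 = 0%N :> int)//= expn1.
  rewrite (_ : Negz n.+1 + 1 = Negz n); last first.
    by rewrite !NegzE -[n.+2]addn1 PoszD opprD subrK.
  by rewrite /= -exprM -expnSr.
- by rewrite /= normrX circ_norm expr1n.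
- have -> : n%:Z + 1 = n.+1 by rewrite -[n.+1]addn1 PoszD.
  by rewrite [Phi_fun x w n.+1]/Phi_fun tau_seqS circ_tau.
- by rewrite /= circ_norm.
Qed.

Definition Phi (R : realType) (x : R) (w : Omega) : solenoid R :=
  SigSub (Phi_in x w).

(* P x is the measure P_x; only 0 <= x < 1 matters. A function on Omega that
   depends only on omega_1, ..., omega_n is given by its n-tuple form f. *)
Definition path_measures (R : realType) (W : R[i] -> R[i])
    (P : R -> probability Omega_borel R) : Prop :=
  forall x : R, 0 <= x < 1 -> forall (n : nat) (f : n.-tuple 'I_3 -> R[i]),
    Cintegral (P x) setT (fun w : Omega_borel => f [tuple w i | i < n]) =
    \sum_(s : n.-tuple 'I_3)
      f s * \prod_(j < n) W (circ (tau_seq x (take j.+1 s))).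

Definition associated_measure (R : realType) (W : R[i] -> R[i])
    (m : probability (solenoid_borel R) R) : Prop :=
  exists P : R -> probability Omega_borel R, path_measures W P /\
    forall f : solenoid R -> R[i]^o, continuous f ->
      Cintegral m setT f =
      Cintegral (@lebesgue_measure R) `[0, 1[
        (fun x => Cintegral (P x) setT (fun w : Omega_borel => f (Phi x w))).

Definition fourier (R : realType) (m : probability (solenoid_borel R) R)
    (lam : rat) : R[i] :=
  Cintegral m setT (chi lam).

Definition m0 (R : realType) (z : R[i]) : R[i] :=
  (1 + z ^+ 2) / (Num.sqrt 2)%:C.

(* The digits start at k = 1. A digit d_0 in {-2, 2} cannot be allowed: z_0 is
   uniformly distributed under the measure associated to any W, so that
   fourier m n = 0 for every integer n <> 0. *)
Definition digit_expansion (p : nat) (d : nat -> int) (lam : rat) : Prop :=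
  (forall k : nat, (1 <= k <= p)%N -> d k \in [:: -2; 0; 2]) /\
  lam = \sum_(1 <= k < p.+1) (d k)%:~R / 3 ^+ k.

(* Main.v *)
(* Let T be the transfer operator T f (x) = \sum_a W (tau_a x) f (tau_a x) and
   e_n = circ ^ n. Every integer n is uniquely 3 n' + d with d in {-2, 0, 2},
   and T e_n = 2 ^ (- |d| / 2) e_n'. The coefficient of m at n / 3 ^ p is the
   integral of T ^ p e_n over [0, 1[, so p such steps turn it into the product
   of the weights of the extracted digits times the integral of some e_k, which
   is 1 if k = 0 and 0 otherwise; k = 0 exactly when the digits expand
   n / 3 ^ p. *)
Require Import Defs.
From HB Require Import structures.
From mathcomp Require Import all_boot all_order all_algebra.
From mathcomp Require Import all_classical all_reals all_analysis.
From mathcomp Require Import complex.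
From mathcomp Require Import ring lra zify.
Import Order.TTheory GRing.Theory Num.Theory.
Import numFieldNormedType.Exports.
Local Open Scope classical_set_scope.
Local Open Scope ring_scope.
Local Open Scope complex_scope.

(** * Integer powers of [circ] and continuity of the characters *)

Lemma circ_neq0 (R : realType) (x : R) : circ x != 0.
Proof. by rewrite -normr_eq0 circ_norm oner_neq0. Qed.

Lemma circN (R : realType) (x : R) : circ (- x) = (circ x)^-1.
Proof.
by apply: (mulIf (circ_neq0 R x)); rewrite -circD addNr circ0 mulVf// circ_neq0.
Qed.

Lemma circMz (R : realType) (x : R) (k : int) : circ (x *~ k) = circ x ^ k.
Proof.
case: k => n; first by rewrite -pmulrn circMn.
by rewrite NegzE mulrNz circN -pmulrn circMn.
Qed.

Lemma solenoid_coord_continuous (R : realType) (n : int) :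
  continuous ((fun z => solenoid_coord z n) : solenoid R -> R[i]^o).
Proof.
move=> z.
apply: (@continuous_comp _ _ _ (set_val : solenoid R -> _)
  (fun f : {ptws int -> R[i]^o} => f n : R[i]^o)).
  exact: initial_continuous.
exact: proj_continuous.
Qed.

Lemma solenoid_coord_neq0 (R : realType) (z : solenoid R) (n : int) :
  solenoid_coord z n != 0.
Proof.
have /(_ n)[_ /= zn] : solenoid_set R (set_val z) by exact: set_valP.
by rewrite -normr_eq0 /solenoid_coord zn oner_neq0.
Qed.

(** Makes every character an admissible test function in [associated_measure]; negative powers are
    harmless because coordinates have modulus 1. *)
Lemma solenoid_coordXz_continuous (R : realType) (n k : int) :
  continuous ((fun z => solenoid_coord z n ^ k) : solenoid R -> R[i]^o).
Proof.
have expn m : continuous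
    ((fun z => solenoid_coord z n ^+ m) : solenoid R -> R[i]^o).
  elim: m => [|m IH] z; first exact: (@cst_continuous _ _ (1 : R[i]^o)).
  under eq_fun do rewrite exprS.
  exact: (@continuousM _ _ _ _ _ (@solenoid_coord_continuous R n z) (IH z)).
case: k => m; first exact: expn.
move=> z; apply: (@continuousV _ _ _ _ _ (expn m.+1 z)).
exact: (expf_neq0 _ (solenoid_coord_neq0 R z n)).
Qed.

(** * Orthogonality of the exponentials on [[0, 1[] *)

Lemma Rintegral_deriv_periodic (R : realType) (f F : R -> R) :
  continuous f -> (forall x : R, is_derive x 1 F (f x)) -> F 0 = F 1 ->
  Rintegral (@lebesgue_measure R) `[0, 1[ f = 0.
Proof.
move=> cf dF F01.
have cF : continuous F.
  by move=> x; apply/differentiable_continuous/derivable1_diffP;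
     exact: (@ex_derive _ _ _ _ _ _ _ (dF x)).
have cf01 : {within `[0, 1], continuous f} by exact: continuous_subspaceT.
rewrite Rintegral_itv_bndo_bndc; last first.
  have If : (@lebesgue_measure R).-integrable `[0, 1] (EFin \o f).
    by apply: continuous_compact_integrable => //; exact: segment_compact.
  apply: integrableS If => //.
  by apply: subset_itvl; rewrite bnd_simp.
rewrite /Rintegral (@continuous_FTC2 _ f F)//.
- by rewrite F01 subee.
- split.
  + by move=> x _; exact: (@ex_derive _ _ _ _ _ _ _ (dF x)).
  + by apply: cvg_at_right_filter; exact: cF.
  + by apply: cvg_at_left_filter; exact: cF.
- by move=> x _; rewrite derive1E; exact: (@derive_val _ _ _ _ _ _ _ (dF x)).
Qed.

(** For [k != 0] the real and imaginary parts have antiderivatives of period 1. The factor [c] will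
    be the product of the digit weights. *)
Lemma Cintegral_circXz (R : realType) (c : R) (k : int) :
  Cintegral (@lebesgue_measure R) `[0, 1[ (fun x => c%:C * circ x ^ k) =
  if k == 0 then c%:C else 0.
Proof.
have [->|k0] := eqVneq k 0.
  have -> : (fun x : R => c%:C * circ x ^ 0) = fun=> c%:C.
    by apply/funext => x; rewrite expr0z mulr1.
  rewrite /Cintegral.
  rewrite /= !Rintegral_cst//= lebesgue_measure_itv/= lte01 oppr0 adde0/=.
  by rewrite mulr1 mul0r.
pose a : R := 2 * pi * k%:~R.
have a0 : a != 0.
  by rewrite !mulf_neq0// ?intr_eq0// gt_eqF// pi_gt0.
have circE x : circ x ^ k = cos (a * x) -i* sin (a * x) :> R[i].
  by rewrite -circMz /circ -[x *~ k]mulrzr mulrA mulrAC.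
(* These values make the antiderivatives agree at 0 and 1. *)
have [ca sa] : cos a = 1 /\ sin a = 0.
  have : circ (1 : R) ^ k = 1 by rewrite circ1 exp1rz.
  by rewrite circE mulr1 => -[-> /eqP]; rewrite oppr_eq0 => /eqP.
have daM (x : R) : is_derive x 1 (fun t : R => a * t) a.
  by apply: is_derive_eq; exact: mulr1.
rewrite -[RHS]/(0 +i* 0) /Cintegral; congr (_ +i* _).
- under eq_Rintegral do rewrite circE /= mul0r subr0.
  apply: (@Rintegral_deriv_periodic _ _ (fun x => (c / a) * sin (a * x))).
  + move=> x; apply: cvgM; first exact: cvg_cst.
    apply: continuous_comp; last exact: continuous_cos.
    exact: mulrl_continuous.
  + move=> x; apply: is_derive_eq; rewrite /GRing.scale/=; field; exact: a0.
  + by rewrite /= mulr1 mulr0 sin0 sa.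
- under eq_Rintegral do rewrite circE /= mul0r addr0.
  apply: (@Rintegral_deriv_periodic _ _ (fun x => (c / a) * cos (a * x))).
  + move=> x; apply: cvgM; first exact: cvg_cst.
    apply: cvgN; apply: continuous_comp; last exact: continuous_sin.
    exact: mulrl_continuous.
  + move=> x; apply: is_derive_eq; rewrite /GRing.scale/=; field; exact: a0.
  + by rewrite /= mulr1 mulr0 cos0 ca.
Qed.

(** * The transfer operator on monomials *)

Lemma sum_tuple_rcons (V : nmodType) (T : finType) (n : nat) (F : seq T -> V) :
  \sum_(s : n.+1.-tuple T) F s =
  \sum_(s : n.-tuple T) \sum_(a : T) F (rcons s a).
Proof.
rewrite pair_bigA/=.
rewrite (reindex (fun p : n.-tuple T * T => [tuple of rcons p.1 p.2]))//=.
apply/onW_bij/inj_card_bij; last by rewrite card_prod !card_tuple expnSr.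
by move=> [s a] [t b] /(congr1 val)/= /rcons_inj[/val_inj -> ->].
Qed.

(** On the unit circle [|1 + z^2|^2 = 2 + z^2 + z^-2]. As a Laurent polynomial in [circ x], the
    weight can be handled by pure algebra. *)
Lemma sqr_norm_m0_circ (R : realType) (x : R) :
  `|m0 (circ x)| ^+ 2 / 3 = 3^-1 + (circ x ^+ 2 + circ x ^- 2) / 6.
Proof.
rewrite /m0 -[circ x ^- 2]exprVn -circN -!circMn mulNrn normrM exprMn.
rewrite normfV exprVn -!add_Re2_Im2 /= expr0n addr0 sqr_sqrtr ?ler0n//.
rewrite /circ /= mulrN cosN sinN opprK.
set c := cos _; set s := sin _.
have cs : c ^+ 2 + s ^+ 2 = 1 by rewrite cos2Dsin2.
have -> : (1 + c) ^+ 2 + (0 - s) ^+ 2 = 2 * (1 + c).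
  by rewrite sub0r sqrrN sqrrD -addrA cs; ring.
have -> : c -i* s + c +i* s = (c + c)%:C.
  by apply/eqP; rewrite eq_complex /= addNr !eqxx.
rewrite [(2 * _)%:C]rmorphM !rmorphD /= !rmorph1; by field.
Qed.

(** Here [z] is a primitive cube root of unity: [z^3 = 1], and [z != 1] since [sin (2 pi / 3) > 0].
    Cancel [z - 1] in [z^3 - 1 = 0]. *)
Lemma sqr_circ_third (R : realType) (z := circ (3^-1 : R)) :
  z ^+ 2 = - 1 - z.
Proof.
have z3 : z ^+ 3 = 1.
  by rewrite -circMn -[_ *+ 3]mulr_natr mulVf ?circ1// pnatr_eq0.
have z1 : z != 1.
  have : 0 < sin (2 * pi * 3^-1 : R).
    by apply: sin_gt0_pi; have := pi_gt0 R; lra.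
  apply: contraTneq; rewrite /z /circ => -[_ /eqP].
  by rewrite oppr_eq0 => /eqP ->; rewrite ltxx.
apply/eqP; rewrite -subr_eq0 -(mulrI_eq0 _ (mulfI (x := z - 1) _)).
  have -> : (z - 1) * (z ^+ 2 - (- 1 - z)) = z ^+ 3 - 1 by ring.
  by rewrite z3 subrr.
by rewrite subr_eq0.
Qed.

(** The three cube roots of [circ y] are [circ (y / 3)] times 1, [z] and [z^2], with
    [1 + z + z^2 = 0]. *)
Lemma sum_circ_tau (R : realType) (y : R) :
  \sum_(a : 'I_3) circ (tau a y) = 0 /\ \sum_(a : 'I_3) circ (tau a y) ^+ 2 = 0.
Proof.
have z2 := sqr_circ_third R; set z := circ _ in z2.
have uz (a : 'I_3) : circ (tau a y) = circ (y / 3) * z ^+ a.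
  by rewrite /tau mulrDl circD mulr_natl circMn.
split; under eq_bigr => a _ do rewrite uz.
  by rewrite !big_ord_recr big_ord0 /= z2; ring.
rewrite !big_ord_recr big_ord0 /= z2.
transitivity (circ (y / 3) ^+ 2 * (2 * (1 + z + z ^+ 2))); first by ring.
by rewrite z2; ring.
Qed.

Lemma powR2_digit (R : realType) (d : int) : d \in [:: -2; 0; 2] ->
  (2 : R) `^ (- `|d|%:~R / 2) = if d == 0 then 1 else 2^-1.
Proof.
by rewrite !inE => /or3P[] /eqP -> /=; rewrite ?normrN ?normr0 ?oppr0 ?mul0r
  ?powRr0// mulNr divff ?pnatr_eq0// powRN powRr1.
Qed.

(* W w * w ^ d is a combination of 1, w and w ^ 2 with coefficients depending
   only on w ^ 3 = circ y, and only the constant term survives the sum over the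
   three cube roots w of circ y. *)
Lemma transfer_monomial (R : realType) (y : R) (k d : int) :
  d \in [:: -2; 0; 2] ->
  \sum_(a : 'I_3) circ (tau a y) ^ (k * 3 + d) *
    (`|m0 (circ (tau a y))| ^+ 2 / 3) =
  ((2 : R) `^ (- `|d|%:~R / 2))%:C * circ y ^ k.
Proof.
move=> dE; set v := circ y.
have v0 : v != 0 by exact: circ_neq0.
under eq_bigr => a _ do rewrite expfzDr ?circ_neq0//
  [_ * 3]mulrC -exprz_exp -exprnP circ_tau -mulrA sqr_norm_m0_circ.
rewrite -mulr_sumr mulrC; congr (_ * _).
suff [[b c] bc] : exists bc : R[i] * R[i], forall w : R[i], w ^+ 3 = v ->
    w ^ d * (3^-1 + (w ^+ 2 + w ^- 2) / 6) =
    (2 `^ (- `|d|%:~R / 2))%:C / 3 + bc.1 * w + bc.2 * w ^+ 2.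
  have [s1 s2] := sum_circ_tau R y.
  under eq_bigr => a _ do rewrite bc ?circ_tau//.
  rewrite !big_split/= -!mulr_sumr s1 s2 !mulr0 !addr0.
  by rewrite sumr_const card_ord -[_ *+ 3]mulr_natr mulVf ?mulr1 ?pnatr_eq0.
have w0 w : w ^+ 3 = v -> w != 0.
  by apply: contra_eqN => /eqP ->; rewrite expr0n eq_sym.
rewrite powR2_digit//; move: dE; rewrite !inE => /or3P[] /eqP -> /=.
(* In each case expand the product and reduce exponents modulo 3 by [w^3 = v]; here [w^-2 = w / v]
   and [w^-4 = w^2 / v^2]. *)
- exists (3^-1 / v, 6^-1 / v ^+ 2) => w /= wv; rewrite -wv.
  rewrite -[w ^ _]/(w ^- 2) fmorphV rmorphD rmorph1. field. exact: w0.
- exists (6^-1 / v, 6^-1) => w /= wv; rewrite -wv.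
  rewrite expr0z. field. exact: w0.
- exists (v / 6, 3^-1) => w /= wv; rewrite -wv.
  rewrite -exprnP fmorphV rmorphD rmorph1. field. exact: w0.
Qed.

(* 3 ^ p * (k + \sum_(1 <= i < p.+1) d i / 3 ^ i), in Horner form. *)
Fixpoint digit_sum (p : nat) (d : nat -> int) (k : int) : int :=
  if p is q.+1 then digit_sum q d k * 3 + d q.+1 else k.

(** Induction on [p], summing out the last letter first: it occurs only in the monomial and in the
    last weight, and its sum removes the lowest digit [d p.+1]. *)
Lemma transfer_iter (R : realType) (x : R) (p : nat) (d : nat -> int)
    (k : int) :
  (forall i, (1 <= i <= p)%N -> d i \in [:: -2; 0; 2]) ->
  \sum_(s : p.-tuple 'I_3) circ (tau_seq x s) ^ digit_sum p d k *
    \prod_(j < p) (`|m0 (circ (tau_seq x (take j.+1 s)))| ^+ 2 / 3) =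
  ((2 : R) `^ (- (\sum_(1 <= i < p.+1) `|d i|)%:~R / 2))%:C * circ x ^ k.
Proof.
elim: p => [|p IH] dE.
  rewrite big_geq// oppr0 mul0r powRr0.
  rewrite (eq_bigr (fun=> circ x ^ k)) => [|s _].
    by rewrite sumr_const card_tuple expn0 mulr1n mul1r.
  by rewrite tuple0 big_ord0 mulr1.
rewrite (@sum_tuple_rcons _ _ _ (fun s =>
    circ (tau_seq x s) ^ digit_sum p.+1 d k *
    \prod_(j < p.+1) (`|m0 (circ (tau_seq x (take j.+1 s)))| ^+ 2 / 3))).
have dp : d p.+1 \in [:: -2; 0; 2] by apply: dE; rewrite leqnn.
rewrite big_nat_recr//= intrD opprD mulrDl powRD; last first.
  by rewrite pnatr_eq0 implybT.
rewrite rmorphM mulrAC -IH => [|i /andP[i1 ip]]; last first.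
  by apply: dE; rewrite i1 leqW.
rewrite mulr_suml; apply: eq_bigr => s _.
under eq_bigr => a _.
  (* The last weight sees the whole tuple, the earlier ones only [s]. *)
  rewrite big_ord_recr /= take_oversize ?size_rcons ?size_tuple//.
  rewrite {1 3}/tau_seq !foldl_rcons -/(tau_seq x s).
  under eq_bigr => j _ do rewrite -cats1 takel_cat ?size_tuple//.
  rewrite mulrCA.
  over.
rewrite -mulr_sumr transfer_monomial//.
by rewrite [LHS]mulrCA [LHS]mulrC; congr (_ * _); exact: mulrC.
Qed.

(** * Expansions with digits -2, 0, 2 *)

Lemma digit_sum_exists (p : nat) (n : int) : exists (d : nat -> int) (k : int),
  (forall i, (1 <= i <= p)%N -> d i \in [:: -2; 0; 2]) /\ n = digit_sum p d k.
Proof.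
elim: p n => [|p IH] n; first by exists (fun=> 0), n; split=> // -[].
have [e [m [eE nE]]] : exists e m : int, e \in [:: -2; 0; 2] /\ n = m * 3 + e.
  have := divz_eq n 3; have := modz_ge0 n (isT : 3 != 0 :> int).
  have := ltz_pmod n (isT : 0 < 3 :> int).
  set r := (n %% 3)%Z; set q := (n %/ 3)%Z => r3 r0 nE.
  (* The digits form a complete residue system modulo 3; remainder 1 becomes digit -2 with a carry
     into the quotient. *)
  have [r0'|[r1|r2]] : r = 0 \/ r = 1 \/ r = 2 by lia.
  - by exists 0, q; rewrite nE r0'.
  - by exists (-2), (q + 1); split=> //; rewrite nE r1; lia.
  - by exists 2, q; rewrite nE r2.
have [d [k [dE mE]]] := IH m.
pose d' i := if i == p.+1 then e else d i.
have d'E q : (q <= p)%N -> digit_sum q d' k = digit_sum q d k.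
  elim: q => //= q IHq qp; rewrite IHq ?(ltnW qp)// /d' ifN//.
  by rewrite eqSS ltn_eqF.
exists d', k; split=> [i /andP[i1 ip]|]; last by rewrite /= d'E// /d' eqxx -mE.
rewrite /d'; case: eqP => // /eqP ip'; apply: dE.
by rewrite i1 -ltnS ltn_neqAle ip'.
Qed.

Lemma digit_sumE (p : nat) (d : nat -> int) :
  \sum_(1 <= i < p.+1) (d i)%:~R / 3 ^+ i =
  (digit_sum p d 0)%:~R / 3 ^+ p :> rat.
Proof.
elim: p => [|p IH]; first by rewrite big_geq// mul0r.
rewrite big_nat_recr//= IH intrD intrM exprS.
have : (3 ^+ p : rat) != 0 by rewrite expf_neq0.
move: (3 ^+ p) => q q0; field. exact: q0.
Qed.

(** * The Fourier coefficients *)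

Lemma eq_Cintegral d (T : measurableType d) (R : realType)
    (mu : {measure set T -> \bar R}) (D : set T) (f g : T -> R[i]) :
  {in D, f =1 g} -> Cintegral mu D f = Cintegral mu D g.
Proof.
by move=> fg; congr (_ +i* _); apply: eq_Rintegral => t tD /=; rewrite fg.
Qed.

Lemma solenoid_coord_Phi (R : realType) (x : R) (w : Omega) (p : nat) :
  solenoid_coord (Phi x w) p = circ (tau_seq x [tuple w i | i < p]).
Proof.
rewrite [LHS]/(circ (tau_seq x (mkseq w p))).
by rewrite /= /mkseq -val_enum_ord -map_comp.
Qed.

Lemma fourier_digit_sum (R : realType) (m : probability (solenoid_borel R) R)
    (p : nat) (d : nat -> int) (k : int) :
  associated_measure (fun z => `|m0 z| ^+ 2 / 3) m ->
  (forall i, (1 <= i <= p)%N -> d i \in [:: -2; 0; 2]) ->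
  fourier m ((digit_sum p d k)%:~R / 3 ^+ p) =
  if k == 0 then ((2 : R) `^ (- (\sum_(1 <= i < p.+1) `|d i|)%:~R / 2))%:C
  else 0.
Proof.
(* The claimed value is rewritten as an integral over [[0, 1[], so that it remains to compare
   integrands pointwise. The character depends on [x] and the first [p] letters only, hence [hP]
   applies. *)
move=> [P [hP hm]] dE; rewrite -Cintegral_circXz /fourier.
under eq_Cintegral do rewrite chiE.
rewrite hm; last exact: solenoid_coordXz_continuous.
apply: eq_Cintegral => x; rewrite inE/= in_itv/= => x01.
rewrite -transfer_iter// -(hP _ x01).
by apply: eq_Cintegral => w _; rewrite solenoid_coord_Phi.
Qed.

Theorem proposition5p6 (R : realType) (m : probability (solenoid_borel R) R)
    (hm : associated_measure (fun z => `|m0 z| ^+ 2 / 3) m)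
    (lam : rat) (hlam : triadic lam) :
  (forall (p : nat) (d : nat -> int), digit_expansion p d lam ->
    fourier m lam =
      ((2 : R) `^ (- (\sum_(1 <= k < p.+1) `|d k|)%:~R / 2))%:C) /\
  ((~ exists (p : nat) (d : nat -> int), digit_expansion p d lam) ->
    fourier m lam = 0).
Proof.
split=> [p d [dE ->]|nexp].
  by rewrite digit_sumE fourier_digit_sum ?eqxx.
have [n [p lamE]] := hlam.
have [d [k [dE nE]]] := digit_sum_exists p n.
(* A zero leading part [k] would make [d] an expansion of [lam]. *)
rewrite lamE nE fourier_digit_sum//; case: eqP => // k0.
by case: nexp; exists p, d; split; rewrite // digit_sumE lamE nE k0.
Qed.
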